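(* There is an absolute constant $C>0$ such that the following holds. Let $d>n$ be positive integers. Then there exists a polynomial $\tilde f_{n,d}=\sum_{\nu} a_\nu X^\nu\in\mathbb{C}[X]$ of degree $<d$ with $\|\tilde f_{n,d}\|_\infty\le 1$ such that $$|a_0+a_1+\dots+a_n| = (1-E)\sum_{\nu=0}^n\binom{-1/2}{\nu}^2$$ for some real number $E$ with $|E|\le C\,n^3\exp\left(-\frac{d}{5n}\right)$.
   Context: For a function $f$ on the open complex unit disk $\mathbb{D}$, $\|f\|_\infty=\sup\{|f(z)|: z\in\mathbb{D}\}$. The binomial coefficient is $\binom{-1/2}{\nu}=\prod_{\kappa=0}^{\nu-1}\frac{-1/2-\kappa}{\nu-\kappa}=(-1)^\nu\frac{1\cdot3\cdots(2\nu-1)}{2\cdot4\cdots 2\nu}$. *)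

(* Defs.v *)
From mathcomp Require Import all_boot all_order all_algebra.
From mathcomp Require Import complex.
From mathcomp Require Import all_classical all_reals all_analysis.

Set Implicit Arguments.
Unset Strict Implicit.
Unset Printing Implicit Defensive.

Import Order.TTheory GRing.Theory Num.Theory.

Local Open Scope classical_set_scope.
Local Open Scope ring_scope.

(* The real-valued modulus; the library norm `|z| on R[i] takes values in R[i]. *)
Definition cmod (R : realType) (z : R[i]) : R := ComplexField.Normc.normc z.

Definition unit_disk (R : realType) : set R[i] := [set z | cmod z < 1].

(* Valued in \bar R, so that an unbounded function has norm +oo. *)
Definition sup_norm (R : realType) (f : R[i] -> R[i]) : \bar R :=
  ereal_sup [set (cmod (f z))%:E | z in @unit_disk R].

Definition gbinom (R : realType) (a : R) (nu : nat) : R :=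
  \prod_(0 <= k < nu) ((a - k%:R) / (nu%:R - k%:R)).

(* Main.v *)
Require Import Defs.
From mathcomp Require Import all_boot all_order all_algebra.
From mathcomp Require Import complex.
From mathcomp Require Import all_classical all_reals all_analysis.
From mathcomp Require Import ring lra.

Set Implicit Arguments.
Unset Strict Implicit.
Unset Printing Implicit Defensive.

Import Order.TTheory GRing.Theory Num.Theory.
Local Open Scope ring_scope.

(** Let q_k = (1 3 ... (2k-1)) / (2 4 ... 2k), the absolute value of the binomial
    coefficient of -1/2 over k, and let Q = q_0 + q_1 X + ... + q_n X^n.  Landau's
    extremal function for the sum of the first n+1 Taylor coefficients is the
    Blaschke product Q^*/Q, where Q^* is Q with its coefficients in reverse order:
    indeed Q^2 agrees with 1/(1-X) up to X^n ([landau_poly_sqr]), so the sum of the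
    first n+1 coefficients of any series f is the n-th coefficient of f Q^2; for
    f = Q^*/Q this is the n-th coefficient of Q^* Q, namely the sum of the q_k^2.

    To obtain a polynomial of degree < d, only the factor 1/Q is truncated: let H be
    a polynomial of degree at most m = d-n-1 with Q H = 1 - X^m S, and T = H Q^*.
    When m > n the sum above is unchanged ([sum_coef_approximant]).  On the disk
    |Q^*| <= |Q|, because Q has no zero there ([reciprocal_norm_le],
    [enestrom_kakeya]), hence |T| <= |H Q| <= 1 + |S|.  As the
    coefficients of S turn out to be nonnegative, |T| <= 1 + S(1), and T divided by
    1 + S(1) is the required polynomial once S(1) is known to be small.

    The quotients q_(k+1)/q_k are at most 1 - 1/(2n) for k < n, so that the
    coefficients of Q(rho X) still decrease for rho = exp(1/(5n)).  Therefore
    Q = (1-F) / (1 - X/rho) where F has nonnegative coefficients, no constant term,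
    and F(rho) = 1.  Truncating the geometric series of F leaves a remainder X^m S
    with nonnegative coefficients, and evaluating at rho, where 1-F vanishes, gives
    the exact value rho^m S(rho) = 1 ([geometric_truncation],
    [truncated_inverse]).  Hence |S| <= S(1) <= S(rho) = rho^(-m), which is
    at most e exp(-d/(5n)).

    If d <= 2n+1, then m does not exceed n, but the required bound on E is at
    least 1, and the zero polynomial with E = 1 is enough. *)

(** * Polynomials with nonnegative coefficients *)

Lemma nonneg_poly_le (R : realFieldType) (p : {poly R}) (x y : R) :
  (forall i, 0 <= p`_i) -> 0 <= x -> x <= y -> p.[x] <= p.[y].
Proof.
move=> p0 x0 xy; rewrite !horner_coef; apply: ler_sum => i _.
by rewrite ler_wpM2l // lerXn2r // ?nnegrE // (le_trans x0).
Qed.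

Lemma normr_horner_nonneg (R : rcfType) (p : {poly R}) (z : R[i]) :
  (forall i, 0 <= p`_i) -> `|z| <= 1 ->
  `|(map_poly (real_complex R) p).[z]| <= (real_complex R p.[1]).
Proof.
move=> p0 z1; rewrite horner_coef size_map_poly [X in real_complex _ X]horner_coef.
rewrite rmorph_sum; apply: (le_trans (ler_norm_sum _ _ _)); apply: ler_sum => i _.
rewrite coef_map normrM normrX expr1n mulr1 /=.
have q0 : 0 <= real_complex R p`_i by rewrite ler0c.
rewrite ger0_norm //; apply: ler_piMr => //; exact: exprn_ile1.
Qed.

(** A truncation of 1/(1-F) whose degree, unlike that of a partial sum of the powers
    of F, is below m.  The point is that the remainder has nonnegative coefficients
    and a weighted sum of coefficients known exactly: the identity is evaluated at
    rho, where 1-F vanishes. *)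
Lemma geometric_truncation (R : realFieldType) (F : {poly R}) (rho : R) (m : nat) :
  (forall i, 0 <= F`_i) -> F`_0 = 0 -> F.[rho] = 1 ->
  exists G S : {poly R},
    [/\ (size G <= m)%N, forall i, 0 <= S`_i, rho ^+ m * S.[rho] = 1 &
        (1 - F) * G = 1 - 'X^m * S].
Proof.
move=> F0 F00 F1.
suff [G [S [sG S0 e]]] : exists G S : {poly R},
    [/\ (size G <= m)%N, forall i, 0 <= S`_i & (1 - F) * G = 1 - 'X^m * S].
  exists G, S; split=> //.
  have := congr1 (fun p => p.[rho]) e.
  rewrite !hornerE F1 subrr mul0r => /esym/eqP.
  by rewrite subr_eq0 => /eqP <-.
elim: m => [|m [G [S [sG S0 e]]]].
  exists 0, 1; split; first by rewrite size_poly0.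
    by move=> i; rewrite coef1 ler0n.
  by rewrite mulr0 expr0 mulr1 subrr.
have dropX (p : {poly R}) : p = (p`_0)%:P + 'X * drop_poly 1 p.
  apply/polyP => i; rewrite coefD coefC coefXM coef_drop_poly.
  by case: i => [|i] /=; rewrite ?addr0 // add0r addn1.
(* The next coefficient of G cancels the lowest term of the remainder; what it
   adds back is a nonnegative multiple of F, divisible by X since F_0 = 0. *)
exists (G + S`_0 *: 'X^m), (drop_poly 1 S + S`_0 *: drop_poly 1 F); split.
- rewrite (leq_trans (size_polyD _ _)) // geq_max (leq_trans sG) //=.
  by rewrite (leq_trans (size_scale_leq _ _)) // size_polyXn.
- by move=> i; rewrite coefD coefZ !coef_drop_poly addr_ge0 // mulr_ge0.
- have eF := dropX F; rewrite F00 add0r in eF.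
  rewrite mulrDr e {1}(dropX S) {1}eF exprS -!mul_polyC; ring.
Qed.

(** When the coefficients of Q(rho X) decrease, (1 - X/rho) Q has the form 1 - F
    required by the truncation of the geometric series: the coefficients of F
    are the successive decrements, which telescope to Q_0 = 1 at X = rho. *)
Lemma truncated_inverse (R : realFieldType) (Q : {poly R}) (rho : R) (m : nat) :
  0 < rho -> Q`_0 = 1 -> (forall i, 0 <= Q`_i) ->
  (forall i, rho * Q`_i.+1 <= Q`_i) ->
  exists H S : {poly R},
    [/\ (size H <= m.+1)%N, forall i, 0 <= S`_i, rho ^+ m * S.[rho] = 1 &
        Q * H = 1 - 'X^m * S].
Proof.
move=> rho0 Q0 Qp Qd.
have rhoN : rho != 0 by rewrite gt_eqF.
pose L : {poly R} := 1 - rho^-1 *: 'X.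
pose F := 1 - L * Q.
have LQ i : (L * Q)`_i = Q`_i - rho^-1 * (if i == 0%N then 0 else Q`_i.-1).
  by rewrite mulrBl mul1r -scalerAl coefB coefZ coefXM.
have Fp i : 0 <= F`_i.
  rewrite coefB coef1 LQ; case: i => [|i] /=; first by rewrite Q0 mulr0 subr0 subrr.
  by rewrite sub0r opprB subr_ge0 mulrC ler_pdivlMr // mulrC.
have F00 : F`_0 = 0 by rewrite coefB coef1 LQ /= Q0 mulr0 subr0 subrr.
have F1 : F.[rho] = 1 by rewrite !hornerE mulVf // subrr mul0r subr0.
have [G [S [sG S0 S1 e]]] := geometric_truncation m Fp F00 F1.
exists (L * G), S; split=> //; last by rewrite -e /F; ring.
rewrite mulrBl mul1r -scalerAl (leq_trans (size_polyD _ _)) // geq_max.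
rewrite (leq_trans sG) //= size_polyN (leq_trans (size_scale_leq _ _)) //.
by rewrite (leq_trans (size_polyMleq _ _)) // size_polyX.
Qed.

(** The truncated inverse with m = 1 and rho = 1 gives Q H = 1 - X S with
    |S| <= S(1) = 1 on the disk, so that a zero z of Q would satisfy z S(z) = 1,
    whereas |z S(z)| <= |z| < 1. *)
Lemma enestrom_kakeya (R : rcfType) (Q : {poly R}) (z : R[i]) :
  Q`_0 = 1 -> (forall i, 0 <= Q`_i) -> (forall i, Q`_i.+1 <= Q`_i) ->
  `|z| < 1 -> (map_poly (real_complex R) Q).[z] != 0.
Proof.
move=> Q0 Qp Qd z1; apply/eqP => Qz.
have Qd1 i : 1 * Q`_i.+1 <= Q`_i by rewrite mul1r.
have [H [S [_ Sp S1 e]]] := truncated_inverse 1 ltr01 Q0 Qp Qd1.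
have := congr1 (fun p => (map_poly (real_complex R) p).[z]) e.
rewrite rmorphM rmorphB rmorph1 rmorphM /= map_polyXn !hornerE Qz mul0r.
move/esym/eqP; rewrite subr_eq0 => /eqP zS.
have := normr_horner_nonneg Sp (ltW z1).
move: S1; rewrite expr1n mul1r => ->; rewrite rmorph1 => Sz.
suff : `|z * (map_poly (real_complex R) S).[z]| < 1 by rewrite -zS normr1 ltxx.
rewrite normrM; apply: le_lt_trans z1.
by rewrite ler_piMr.
Qed.

(** * The Blaschke product of a polynomial without zeros in the disk *)

Definition reciprocal (C : numClosedFieldType) (p : {poly C}) : {poly C} :=
  \poly_(i < size p) (p`_((size p).-1 - i))^*.

Lemma reciprocal_horner (C : numClosedFieldType) (p : {poly C}) (z : C) :
  z != 0 ->
  (reciprocal p).[z] = z ^+ (size p).-1 * (p.[(z^*)^-1])^*.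
Proof.
move=> z0; rewrite horner_poly horner_coef rmorph_sum mulr_sumr.
rewrite (reindex_inj rev_ord_inj) /=; apply: eq_bigr => i _.
have ip : (i <= (size p).-1)%N by rewrite -ltnS (leq_trans (ltn_ord i)) // leqSpred.
rewrite rmorphM rmorphXn fmorphV /= conjCK exprVn.
have -> : (size p - i.+1 = (size p).-1 - i)%N by case: (size p) i ip => [|n] [].
rewrite subKn // mulrCA; congr (_ * _).
by rewrite -expfB_cond // (negPf z0).
Qed.

(** The difference of the squares is (|r|^2 - 1) (1 - |z|^2). *)
Lemma blaschke_factor_le (C : numClosedFieldType) (r z : C) :
  1 <= `|r| -> `|z| <= 1 -> `|1 - z * r^*| <= `|z - r|.
Proof.
move=> r1 z1; rewrite -(@ler_pXn2r _ 2) ?nnegrE // !normCK -subr_ge0.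
rewrite !rmorphB rmorphM rmorph1 /= conjCK.
have -> : (z - r) * (z^* - r^*) - (1 - z * r^*) * (1 - z^* * r)
          = (r * r^* - 1) * (1 - z * z^*) by ring.
by rewrite -!normCK mulr_ge0 // subr_ge0 ?exprn_ege1 // exprn_ile1.
Qed.

(** Over the roots r of p, the quotient of the two sides is the product of the
    Blaschke factors (1 - z conj(r)) / (z - r), each of modulus at most 1 as
    every root has modulus at least 1.  The product formula for the reciprocal needs
    z != 0; at 0 the claim is that the product of the roots has modulus
    at least 1. *)
Lemma reciprocal_norm_le (C : numClosedFieldType) (p : {poly C}) (z : C) :
  (forall w, `|w| < 1 -> p.[w] != 0) -> `|z| < 1 ->
  `|(reciprocal p).[z]| <= `|p.[z]|.
Proof.
move=> pN z1.
have [rs pE] := closed_field_poly_normal p.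
have p0 : p != 0.
  by apply: contraNneq (pN 0 _) => [->|]; rewrite ?normr0 ?horner0.
have lc0 : lead_coef p != 0 by rewrite lead_coef_eq0.
have sp : size p = (size rs).+1.
  by rewrite pE size_scale // size_prod_XsubC.
have rs1 r : r \in rs -> 1 <= `|r|.
  move=> rrs; rewrite real_leNgt ?num_real // ?normr_real //.
  apply/negP => /pN /negP; apply.
  by rewrite -[_ == 0]/(root p r) pE rootZ // root_prod_XsubC.
have pz w : p.[w] = lead_coef p * \prod_(r <- rs) (w - r).
  rewrite {1}pE hornerZ horner_prod; congr (_ * _).
  by apply: eq_bigr => r _; rewrite !hornerE.
have [->|z0] := eqVneq z 0.
  rewrite horner_coef0 coef_poly sp /= subn0 pz.
  have -> : p`_(size rs) = lead_coef p by rewrite lead_coefE sp.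
  rewrite norm_conjC normrM ler_peMr // normr_prod.
  rewrite big_seq; elim/big_ind: _ => // [x y x1 y1|r /rs1]; first exact: mulr_ege1.
  by rewrite sub0r normrN.
rewrite reciprocal_horner // sp /= !pz.
rewrite rmorphM rmorph_prod mulrCA !normrM norm_conjC ler_wpM2l //.
rewrite -normrM.
have -> : z ^+ size rs = \prod_(r <- rs) z.
  by rewrite big_const_seq count_predT -Monoid.iteropE.
rewrite -big_split /= !normr_prod.
rewrite big_seq [X in _ <= X]big_seq.
apply: ler_prod => r rrs; rewrite normr_ge0 /=.
rewrite rmorphB fmorphV /= conjCK mulrBr mulfV //.
by apply: blaschke_factor_le (rs1 _ rrs) (ltW z1).
Qed.

(** * The truncated binomial series of exponent -1/2 *)

Definition landau_coef (R : realFieldType) (k : nat) : R :=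
  \prod_(0 <= j < k) ((2 * j%:R + 1) / (2 * j%:R + 2)).

Lemma landau_coefS (R : realFieldType) (k : nat) :
  (2 * k%:R + 2) * landau_coef R k.+1 = (2 * k%:R + 1) * landau_coef R k.
Proof.
rewrite /landau_coef big_nat_recr //=; field.
by rewrite gt_eqF // ltr_wpDl // mulr_ge0.
Qed.

Lemma landau_coef_gt0 (R : realFieldType) (k : nat) : 0 < landau_coef R k.
Proof.
apply: prodr_gt0 => j _.
by rewrite divr_gt0 // ltr_wpDl // mulr_ge0.
Qed.

Lemma gbinom_half (R : realType) (k : nat) :
  gbinom (- (1 / 2)) k ^+ 2 = landau_coef R k ^+ 2.
Proof.
have den (a : R) : gbinom a k = \prod_(0 <= j < k) ((a - j%:R) / (j%:R + 1)).
  rewrite /gbinom !prodf_div; congr (_ / _).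
  rewrite [RHS]big_nat_rev /= add0n; apply: eq_big_nat => j /andP[_ jk].
  by rewrite natr1 -natrB ?(ltnW jk) // subnSK.
rewrite den /landau_coef -!prodrXl; apply: eq_bigr => j _.
have j0 : j%:R + 1 != 0 :> R by rewrite natr1 pnatr_eq0.
have j1 : 2 * j%:R + 2 != 0 :> R.
  by rewrite -[X in _ + X]mulr1 -mulrDr mulf_neq0 // pnatr_eq0.
by field; rewrite j0 j1.
Qed.

Definition landau_poly (R : realFieldType) (n : nat) : {poly R} :=
  \poly_(i < n.+1) landau_coef R i.

Lemma landau_poly_ge0 (R : realFieldType) (n i : nat) : 0 <= (landau_poly R n)`_i.
Proof. by rewrite coef_poly; case: ifP => // _; exact/ltW/landau_coef_gt0. Qed.

(** The worst quotient of consecutive coefficients is the last one,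
    q_n / q_(n-1) = 1 - 1/(2n); beyond n the coefficients vanish. *)
Lemma landau_poly_decreasing (R : realFieldType) (n i : nat) (rho : R) :
  (0 < n)%N -> rho * (1 - (2 * n%:R)^-1) <= 1 ->
  rho * (landau_poly R n)`_i.+1 <= (landau_poly R n)`_i.
Proof.
move=> n0 hrho; rewrite [X in _ * X]coef_poly; case: ltnP => [lt_in|_]; last first.
  by rewrite mulr0 landau_poly_ge0.
rewrite coef_poly (ltnW lt_in); rewrite ltnS in lt_in.
have c0 := landau_coef_gt0 R i; have e := landau_coefS R i.
have i0 : 0 <= i%:R :> R by [].
have n1 : 0 < n%:R :> R by rewrite ltr0n.
have ni : i%:R + 1 <= n%:R :> R by rewrite natr1 ler_nat.
have d0 : 0 < 2 * i%:R + 2 :> R by lra.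
have -> : landau_coef R i.+1 = (1 - (2 * i%:R + 2)^-1) * landau_coef R i.
  apply: (mulfI (lt0r_neq0 d0)); rewrite e; field; exact: lt0r_neq0.
rewrite mulrA; apply: ler_piMl; first exact: ltW.
have [r0|r0] := ltP 0 rho; last first.
  apply: (le_trans _ ler01); apply: mulr_le0_ge0 => //.
  by rewrite subr_ge0 invf_le1 //; lra.
apply: le_trans hrho; rewrite ler_pM2l // lerB // lef_pV2 ?posrE //; lra.
Qed.

(** The square of the series of (1-X)^(-1/2) is 1/(1-X).  The truncated series Q
    satisfies 2 (1-X) Q' = Q up to a multiple of X^n, whence (1-X) (Q^2)' = Q^2
    modulo X^n, and this says that consecutive coefficients of Q^2
    are equal up to index n. *)
Lemma landau_poly_sqr (R : realFieldType) (n k : nat) :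
  (k <= n)%N -> (landau_poly R n * landau_poly R n)`_k = 1.
Proof.
set Q := landau_poly R n.
have ode : 2 *: ((1 - 'X) * Q^`()) =
    Q - ((2 * n%:R + 1) * landau_coef R n) *: 'X^n.
  apply/polyP => i; rewrite coefZ mulrBl mul1r !coefB coefXM !coef_deriv.
  rewrite coefZ coefXn !coef_poly.
  case: i => [|i] /=.
    rewrite ltnS subr0 eq_sym; have := landau_coefS R 0.
    by case: (posnP n) => [->|n0] /=; rewrite ?mulr0n ?mulr1n; lra.
  have := landau_coefS R i.+1; rewrite !ltnS.
  rewrite -[X in 2 * (X - _)]mulr_natr -[X in 2 * (_ - X)]mulr_natr.
  have -> : i.+2%:R = i.+1%:R + 1 :> R by rewrite natr1.
  have [lt|gt|<-] := ltngtP i.+1 n; rewrite ?mulr1 ?mulr0 /=.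
  - move: (landau_coef R i.+2) (landau_coef R i.+1) i.+1%:R => a b x h.
    transitivity ((2 * x + 2) * a - 2 * x * b); first by ring.
    by rewrite h; ring.
  - by rewrite !mul0r !subr0 mulr0.
  - by move=> _; ring.
have sqr0 : (Q * Q)`_0 = 1.
  by rewrite coefM big_ord1 coef_poly /= /landau_coef big_nil mulr1.
have step i : (i < n)%N -> (Q * Q)`_i.+1 = (Q * Q)`_i.
  move=> lt_in.
  have := congr1 (fun p : {poly R} => (p * Q)`_i) ode.
  have -> : 2 *: ((1 - 'X) * Q^`()) * Q = (1 - 'X) * (Q * Q)^`().
    by rewrite derivM scaler_nat; ring.
  rewrite mulrBl mul1r mulrBl -scalerAl !coefB coefZ coefXnM lt_in mulr0 subr0.
  rewrite coefXM !coef_deriv.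
  have i1 : i.+1%:R != 0 :> R by rewrite pnatr_eq0.
  case: i lt_in i1 => [|i] lt_in i1 /=; first by rewrite subr0 mulr1n.
  move/eqP; rewrite subr_eq => /eqP h; apply: (mulfI i1).
  by rewrite !mulr_natl h -mulrS.
elim: k => [|k IH] lt_kn; first exact: sqr0.
by rewrite step // IH // ltnW.
Qed.

(** Since Q^2 agrees with 1/(1-X) up to degree n, multiplying by Q^2 sums the
    coefficients; one factor Q cancels H up to X^m, and the other turns the reversed
    polynomial into a sum of squares. *)
Lemma sum_coef_approximant (R : comNzRingType) (n m : nat) (Q Qr H S : {poly R}) :
  (n < m)%N -> (forall k, (k <= n)%N -> (Q * Q)`_k = 1) ->
  (forall k, (k <= n)%N -> Qr`_k = Q`_(n - k)) ->
  Q * H = 1 - 'X^m * S ->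
  \sum_(0 <= k < n.+1) (H * Qr)`_k = \sum_(0 <= k < n.+1) Q`_k ^+ 2.
Proof.
move=> nm Q2 Qrev e; rewrite big_mkord.
transitivity ((H * Qr) * (Q * Q))`_n.
  rewrite coefM; apply: eq_bigr => k _.
  by rewrite Q2 ?mulr1 // leq_subr.
have -> : H * Qr * (Q * Q) = Qr * Q - 'X^m * (S * Qr * Q).
  rewrite -[Qr * Q in RHS]mul1r.
  transitivity ((Q * H) * (Qr * Q)); first by ring.
  by rewrite e; ring.
rewrite coefB coefXnM nm subr0 coefM big_mkord [RHS](reindex_inj rev_ord_inj) /=.
apply: eq_bigr => k _; by rewrite subSS Qrev -1?ltnS.
Qed.

(** * The approximating polynomial *)

Definition rev_poly (R : nzRingType) (p : {poly R}) : {poly R} :=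
  \poly_(i < size p) p`_((size p).-1 - i).

Lemma reciprocal_map_real (R : rcfType) (Q : {poly R}) :
  reciprocal (map_poly (real_complex R) Q) =
  map_poly (real_complex R) (rev_poly Q).
Proof.
apply/polyP => i; rewrite [RHS]coef_map [LHS]coef_poly.
rewrite [X in _ = _ X]coef_poly size_map_poly.
case: ifP => // _.
by rewrite coef_map /= conj_Creal //; apply/complex_realP; eexists.
Qed.

(** Truncating 1/Q rather than the quotient Q^*/Q lets |Q^*| <= |Q| act as
    a factor: |H Q^*| <= |H Q| = |1 - z^m S|. *)
Lemma approximant_norm_le (R : rcfType) (Q H S : {poly R}) (m : nat) (z : R[i]) :
  Q`_0 = 1 -> (forall i, 0 <= Q`_i) -> (forall i, Q`_i.+1 <= Q`_i) ->
  (forall i, 0 <= S`_i) -> Q * H = 1 - 'X^m * S -> `|z| < 1 ->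
  `|(map_poly (real_complex R) (H * rev_poly Q)).[z]| <= real_complex R (1 + S.[1]).
Proof.
move=> Q0 Qp Qd Sp e z1.
rewrite rmorphM /= hornerM -reciprocal_map_real.
apply: (@le_trans _ _ `|(map_poly (real_complex R) (Q * H)).[z]|).
  rewrite rmorphM /= hornerM !normrM mulrC ler_wpM2r //.
  by apply: reciprocal_norm_le => // w w1; exact: enestrom_kakeya.
rewrite e rmorphB rmorph1 rmorphM /= map_polyXn !hornerE rmorphD rmorph1 /=.
apply: (le_trans (ler_normB _ _)); rewrite normr1 lerD2l normrM normrX.
have Sz := normr_horner_nonneg Sp (ltW z1).
apply: le_trans Sz; rewrite ler_piMl // exprn_ile1 //; exact: ltW.
Qed.

Lemma normr_cmod (R : realType) (z : R[i]) : `|z| = real_complex R (cmod z).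
Proof. by case: z. Qed.

Theorem theorem2p1 (R : realType) :
  exists C : R, 0 < C /\
    forall d n : nat, (0 < n)%N -> (n < d)%N ->
      exists f : {poly R[i]},
        [/\ (size f <= d)%N,
            (sup_norm (fun z => f.[z]) <= 1)%E &
            exists E : R,
              cmod (\sum_(0 <= nu < n.+1) f`_nu)
                = (1 - E) * \sum_(0 <= nu < n.+1) gbinom (- (1 / 2)) nu ^+ 2
              /\ `|E| <= C * n%:R ^+ 3 * expR (- (d%:R / (5 * n%:R)))].
Proof.
exists (expR 1); split=> [|d n n0 nd]; first exact: expR_gt0.
have n1 : 1 <= n%:R :> R by rewrite ler1n.
have n5 : 0 < 5 * n%:R :> R by lra.
(* The factor e pays for exp((n+1)/(5n)), lost when d is replaced by d-n-1, and makes
   the bound at least 1 when d <= 2n+1. *)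
have errB (x : R) : x <= expR (1 - d%:R / (5 * n%:R)) ->
    x <= expR 1 * n%:R ^+ 3 * expR (- (d%:R / (5 * n%:R))).
  by move=> /le_trans; apply; rewrite expRD mulrAC ler_peMr ?exprn_ege1.
have [d2|d2] := leqP d (n.*2.+1).
  exists 0; split; first by rewrite size_poly0.
    apply: ge_ereal_sup => _ [z _ <-]; rewrite horner0 lee_fin.
    by rewrite -lecR -normr_cmod normr0 ler01.
  exists 1; split.
    rewrite subrr mul0r big1 => [|i _]; last by rewrite coef0.
    by apply/eqP; rewrite -(inj_eq (@complexI R)) -normr_cmod normr0.
  rewrite normr1; apply: errB; rewrite -[X in X <= _]expR0 ler_expR.
  rewrite subr_ge0 ler_pdivrMr // mul1r.
  have : d%:R <= (n.*2.+1)%:R :> R by rewrite ler_nat.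
  by rewrite -natr1 -muln2 natrM; lra.
(* The largest m for which H * Q^*, of degree at most m + n, has degree < d. *)
pose m := (d - n.+1)%N.
have nm : (n < m)%N by rewrite ltn_subRL addSn addnn.
pose rho : R := expR (5 * n%:R)^-1.
have rho0 : 0 < rho by exact: expR_gt0.
have rho1 : 1 <= rho by rewrite -[X in X <= _]expR0 ler_expR invr_ge0 ltW.
pose Q := landau_poly R n.
have szQ : size Q = n.+1 by rewrite size_poly_eq //= gt_eqF // landau_coef_gt0.
have Q0 : Q`_0 = 1 by rewrite coef_poly /= /landau_coef big_nil.
have Qp := landau_poly_ge0 R n.
(* exp(-1/(5n)) >= 1 - 1/(5n) >= 1 - 1/(2n) *)
have hrho : rho * (1 - (2 * n%:R)^-1) <= 1.
  rewrite -ler_pdivlMl // mulr1 /rho -expRN; apply: le_trans (expR_ge1Dx _).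
  by rewrite lerD2l lerN2 lef_pV2 ?posrE //; lra.
have Qrho i : rho * Q`_i.+1 <= Q`_i by exact: landau_poly_decreasing.
have Qd i : Q`_i.+1 <= Q`_i by apply: le_trans (Qrho i); rewrite ler_peMl.
have [H [S [sH Sp S1 e]]] := truncated_inverse m rho0 Q0 Qp Qrho.
have delta0 : 0 <= S.[1].
  by rewrite horner_coef sumr_ge0 // => i _; rewrite expr1n mulr1.
have deltaB : S.[1] <= expR (1 - d%:R / (5 * n%:R)).
  apply: (le_trans (nonneg_poly_le Sp ler01 rho1)).
  have -> : S.[rho] = expR (- (m%:R / (5 * n%:R))).
    apply: (mulfI (expf_neq0 m (lt0r_neq0 rho0))); rewrite S1.
    by rewrite /rho -expRM_natl -expRD mulrC subrr expR0.
  rewrite ler_expR natrB // -natr1 -subr_ge0.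
  have -> : 1 - d%:R / (5 * n%:R) - - ((d%:R - (n%:R + 1)) / (5 * n%:R))
          = (4 * n%:R - 1) / (5 * n%:R) :> R by field; lra.
  by rewrite divr_ge0 //; lra.
pose T := (1 + S.[1])^-1 *: (H * rev_poly Q).
have d1 : 0 < 1 + S.[1] by lra.
exists (map_poly (real_complex R) T); split.
- rewrite size_map_poly (leq_trans (size_scale_leq _ _)) //.
  rewrite (leq_trans (size_polyMleq _ _)) //.
  have : (size (rev_poly Q) <= n.+1)%N by rewrite -szQ size_poly.
  move=> /(leq_add sH); rewrite /m addSn subnK // => h.
  by rewrite -ltnS (leq_trans (leqSpred _)) //; case: (_ + _)%N h.
- apply: ge_ereal_sup => _ [z z1 <-]; rewrite lee_fin -lecR -normr_cmod.
  have bound : cmod (map_poly (real_complex R) (H * rev_poly Q)).[z] <= 1 + S.[1].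
    rewrite -lecR -normr_cmod; apply: approximant_norm_le e _ => //.
    by rewrite normr_cmod ltcR.
  rewrite /T map_polyZ hornerZ normrM ger0_norm ?ler0c ?invr_ge0; last exact: ltW.
  by rewrite normr_cmod -rmorphM lecR ler_pdivrMl // mulr1.
exists (S.[1] / (1 + S.[1])); split; last first.
  rewrite ger0_norm ?divr_ge0 //; last exact: ltW.
  by apply: errB; apply: le_trans deltaB; rewrite ler_pdivrMr // ler_peMr //; lra.
have sumT : \sum_(0 <= k < n.+1) T`_k =
    (1 - S.[1] / (1 + S.[1])) * \sum_(0 <= k < n.+1) gbinom (- (1 / 2)) k ^+ 2.
  under eq_bigr do rewrite coefZ.
  rewrite -mulr_sumr (sum_coef_approximant nm _ _ e).
  - have -> : 1 - S.[1] / (1 + S.[1]) = (1 + S.[1])^-1 by field; rewrite gt_eqF.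
    congr (_ * _); apply: eq_big_nat => k /andP[_ kn].
    by rewrite coef_poly kn gbinom_half.
  - by move=> k; exact: landau_poly_sqr.
  - by move=> k kn; rewrite coef_poly szQ ltnS kn.
rewrite -sumT; under eq_bigr do rewrite coef_map.
rewrite -rmorph_sum; apply: (@complexI R); rewrite -normr_cmod ger0_norm // ler0c.
rewrite sumT mulr_ge0 ?sumr_ge0 // => [|k _]; last exact: sqr_ge0.
by rewrite subr_ge0 ler_pdivrMr // mul1r; lra.
Qed.
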